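(* Let $r$ and $n$ be integers with $r \geq n \geq 3$. If $M$ is a simple rank-$r$ binary matroid that is $\mathrm{PG}(n-1,2)$-free and satisfies $|M| > \left(1-\frac{3}{2^n}\right)2^r$, then there is a hyperplane $L$ of $M$ such that $M|L$ is $\mathrm{PG}(n-2,2)$-free. Furthermore, $|L| > \left(1-\frac{3}{2^{n-1}}\right)2^{r-1}$.
   Context: A matroid is $N$-free if it has no restriction isomorphic to $N$. $\mathrm{PG}(k-1,2)$ denotes the binary projective geometry of rank $k$, and $|M|$ is the size of the ground set of $M$. *)

(* Defs.v *)
From mathcomp Require Import all_boot all_order all_algebra.

Set Implicit Arguments.
Unset Strict Implicit.
Unset Printing Implicit Defensive.

Import GRing.Theory.

(* The ground set is a subset of a carrier type, so that restrictions of a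
   matroid on [T] are again matroids on [T]. *)
Record matroid (T : finType) := Matroid {
  ground : {set T};
  indep : pred {set T};
  indep_ground : forall I, indep I -> I \subset ground;
  indep0 : indep set0;
  indepS : forall I J : {set T}, J \subset I -> indep I -> indep J;
  indep_augment : forall I J : {set T}, indep I -> indep J -> #|I| < #|J| ->
    exists2 x, x \in J :\: I & indep (x |: I)
}.

Section Notions.
Variables (T : finType) (M : matroid T).

Definition mrank (X : {set T}) : nat :=
  \max_(I : {set T} | (I \subset X) && indep M I) #|I|.

Definition circuit (C : {set T}) : bool :=
  minset [pred X : {set T} | (X \subset ground M) && ~~ indep M X] C.

(* Circuits of size 1 are the loops, those of size 2 the parallel pairs. *)
Definition simple_matroid : Prop := forall C, circuit C -> 2 < #|C|.

Definition mclosure (X : {set T}) : {set T} :=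
  [set x in ground M | mrank (x |: X) == mrank X].

Definition flat (X : {set T}) : bool :=
  (X \subset ground M) && (mclosure X == X).

Definition hyperplane (H : {set T}) : bool :=
  flat H && ((mrank H).+1 == mrank (ground M)).

Section Restriction.
Variable X : {set T}.

Definition restr_indep : pred {set T} :=
  [pred I : {set T} | (I \subset X) && indep M I].

Fact restr_ground I : restr_indep I -> I \subset ground M :&: X.
Proof. by case/andP=> IX /indep_ground IE; rewrite subsetI IE. Qed.

Fact restr_indep0 : restr_indep set0.
Proof. by apply/andP; rewrite sub0set indep0. Qed.

Fact restr_indepS (I J : {set T}) :
  J \subset I -> restr_indep I -> restr_indep J.
Proof.
by move=> JI /andP[IX iI]; apply/andP; rewrite (subset_trans JI IX) (indepS JI iI).
Qed.

Fact restr_augment (I J : {set T}) :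
  restr_indep I -> restr_indep J -> #|I| < #|J| ->
  exists2 x, x \in J :\: I & restr_indep (x |: I).
Proof.
move=> /andP[IX iI] /andP[JX iJ] /(indep_augment iI iJ)[x xJI ixI].
exists x => //; apply/andP; split=> //; rewrite subUset IX andbT sub1set.
by apply: (subsetP JX); case/setDP: xJI.
Qed.

Definition restrict : matroid T :=
  Matroid restr_ground restr_indep0 restr_indepS restr_augment.

End Restriction.

(* [free] is linear independence of a sequence: a repeated vector makes it
   false, so parallel elements may share a representing vector. *)
Definition representable (F : fieldType) : Prop :=
  exists (m : nat) (f : T -> 'rV[F]_m), forall I : {set T},
    I \subset ground M -> indep M I = free [seq f x | x <- enum I].

Definition binary : Prop := representable 'F_2.

End Notions.

(* The bijection is between the ground sets viewed as types, so that nothing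
   depends on the elements of the carriers outside the ground sets. *)
Definition matroid_iso (T U : finType) (M : matroid T) (N : matroid U) : Prop :=
  exists f : {x : T | x \in ground M} -> {y : U | y \in ground N},
    bijective f /\
    forall I : {set {x : T | x \in ground M}},
      indep M [set val x | x in I] = indep N [set val (f x) | x in I].

Definition matroid_free (T U : finType) (N : matroid U) (M : matroid T) : Prop :=
  ~ exists2 X : {set T}, X \subset ground M & matroid_iso (restrict M X) N.

Section VectorMatroid.
Variables (F : finFieldType) (m : nat) (E : {set 'rV[F]_m}).

Definition vect_indep : pred {set 'rV[F]_m} :=
  [pred I : {set 'rV[F]_m} | (I \subset E) && free (enum I)].

Fact vect_ground I : vect_indep I -> I \subset E.
Proof. by case/andP. Qed.

Fact vect_indep0 : vect_indep set0.
Proof. by apply/andP; rewrite sub0set enum_set0 nil_free. Qed.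

Fact vect_indepS (I J : {set 'rV[F]_m}) :
  J \subset I -> vect_indep I -> vect_indep J.
Proof.
move=> JI /andP[IE fI]; apply/andP; split; first exact: subset_trans JI IE.
have -> : enum J = [seq x <- enum I | x \in J].
  rewrite -filter_predI; apply: eq_filter => x /=.
  by case xJ: (x \in J) => //=; rewrite (subsetP JI).
exact: filter_free.
Qed.

Fact vect_augment (I J : {set 'rV[F]_m}) :
  vect_indep I -> vect_indep J -> #|I| < #|J| ->
  exists2 x, x \in J :\: I & vect_indep (x |: I).
Proof.
move=> /andP[IE fI] /andP[JE fJ] ltIJ.
have [/hasP[x xJ xI] | /hasPn JI] :=
  boolP (has (fun x => x \notin <<enum I>>%VS) (enum J)).
  rewrite mem_enum in xJ.
  have xNI : x \notin I.
    by apply: contra xI => xI; apply: memv_span; rewrite mem_enum.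
  exists x; first by rewrite inE xNI.
  apply/andP; split; first by rewrite subUset sub1set (subsetP JE).
  have /perm_free -> : perm_eq (enum (x |: I)) (x :: enum I).
    apply: uniq_perm; rewrite /= ?mem_enum ?xNI ?enum_uniq // => y.
    by rewrite mem_enum !inE mem_enum.
  by rewrite free_cons xI.
have /dimvS : (<<enum J>> <= <<enum I>>)%VS.
  by apply/span_subvP => x /JI; rewrite negbK.
by move: fI fJ ltIJ; rewrite /free !cardE => /eqP-> /eqP->; case: ltnP.
Qed.

Definition vector_matroid : matroid 'rV[F]_m :=
  Matroid vect_ground vect_indep0 vect_indepS vect_augment.

End VectorMatroid.

(* The binary projective geometry PG(d, 2), of rank d + 1: over the two-element
   field every one-dimensional subspace has exactly one nonzero vector. *)
Definition PG2 (d : nat) : matroid 'rV['F_2]_d.+1 :=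
  vector_matroid [set v : 'rV['F_2]_d.+1 | v != 0%R].

(* Main.v *)
(* Represent M by a set E of nonzero vectors of V = F_2^r, with complement Y of
   size less than 3 * 2^(r-n).  It suffices to find a linear hyperplane H such
   that E :&: H contains no punctured (n-1)-dimensional subspace; the bound on
   |L| and the fact that E :&: H spans H then follow by counting.

   If E contains a punctured subspace U0 of dimension n-1, choose in it K0 of
   dimension n-3.  The cosets of K0 contained in E cover more than 5/8 of V, and
   since no coset of U0 lies in E, averaging over the three spaces K with
   K0 < K < U0 of dimension n-2 yields one for which the union A of the cosets
   of K contained in E has more than |V|/3 elements.  As E contains no punctured
   n-dimensional subspace, A is sum-free, and a Fourier argument gives a
   hyperplane H disjoint from A; since A is K-periodic, K is contained in H.

   Every coset of K in H meets Y, because H misses A.  If E :&: H contained a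
   punctured (n-1)-dimensional subspace U, every coset of U outside H would meet
   Y as well, so |Y| >= 2^(r-n+1) + 2^(r-n), a contradiction. *)
Require Import Defs.
From HB Require Import structures.
From mathcomp Require Import all_boot all_order all_algebra.
From mathcomp Require Import finfield zify ring.

Set Implicit Arguments.
Unset Strict Implicit.
Unset Printing Implicit Defensive.

Import Order.TTheory GRing.Theory Num.Theory.

Local Open Scope ring_scope.

(** * Arithmetic in characteristic two *)

Lemma F2P (x : 'F_2) : x = 0 \/ x = 1.
Proof. by case: x => [[|[|//]] ?]; [left | right]; apply: val_inj. Qed.

Lemma addvv2 (vT : lmodType 'F_2) (v : vT) : v + v = 0.
Proof.
by rewrite -[v]scale1r -scalerDl (_ : 1 + 1 = 0 :> 'F_2) ?scale0r //; apply: val_inj.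
Qed.

Lemma addvK2 (vT : lmodType 'F_2) (v : vT) : involutive (+%R v).
Proof. by move=> w; rewrite addrA addvv2 add0r. Qed.

(** * Fourier analysis of sum-free sets in the vector space over the two-element field *)

Section Characters.
Variable r : nat.
Local Notation V := 'rV['F_2]_r.
Implicit Types (v w xi : V) (A : {set V}).

Definition dot v xi : 'F_2 := (v *m xi^T) 0 0.

Lemma dotDl v w xi : dot (v + w) xi = dot v xi + dot w xi.
Proof. by rewrite /dot mulmxDl mxE. Qed.

Lemma dotC v w : dot v w = dot w v.
Proof. by rewrite /dot -[v *m w^T]trmxK mxE trmx_mul trmxK. Qed.

Lemma dot0l xi : dot 0 xi = 0.
Proof. by rewrite /dot mul0mx mxE. Qed.

Lemma dot_nondeg xi : xi != 0 -> exists v, dot v xi = 1.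
Proof.
case/rV0Pn=> i xi_i; exists (delta_mx 0 i).
by rewrite dotC /dot trmx_delta -colE mxE; case: (F2P (xi 0 i)) xi_i => ->.
Qed.

Definition hyp xi := [set v | dot v xi == 0].

Lemma hypC_shift w xi : dot w xi = 1 -> [set w + v | v in hyp xi] = ~: hyp xi.
Proof.
move=> w1; apply/setP=> v; rewrite !inE; apply/imsetP/idP => [[u] | v1].
  by rewrite inE => /eqP u0 ->; rewrite dotDl w1 u0.
exists (w + v); last by rewrite addvK2.
by rewrite inE dotDl w1; case: (F2P (dot v xi)) v1 => ->.
Qed.

Lemma card_hyp xi : xi != 0 ->
  (2 * #|hyp xi| = #|{: V}|)%N /\ (2 * #|~: hyp xi| = #|{: V}|)%N.
Proof.
case/dot_nondeg=> w w1; rewrite -(cardsC (hyp xi)) -(hypC_shift w1).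
by rewrite card_imset; [split; rewrite mul2n -addnn | exact: can_inj (addvK2 w)].
Qed.

Lemma mem_hyp_lker v xi : (v \in hyp xi) = (v \in lker (linfun (mulmxr xi^T))).
Proof.
rewrite inE memv_ker lfunE /= [v *m _]mx11_scalar -/(dot v xi).
by apply/eqP/eqP => [-> | /matrixP/(_ 0 0)]; [exact: raddf0 | rewrite !mxE].
Qed.

Definition chi xi v : int := if dot v xi == 0 then 1 else -1.

Lemma chiD xi v w : chi xi (v + w) = chi xi v * chi xi w.
Proof.
rewrite /chi dotDl.
by case: (F2P (dot v xi)) => ->; case: (F2P (dot w xi)) => ->.
Qed.

(** Orthogonality of characters: for nonzero [v], shifting [xi] by some [w] with [dot w v = 1] flips
    every sign. *)
Lemma sum_chi v : \sum_xi chi xi v = if v == 0 then #|{: V}|%:Z else 0.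
Proof.
case: eqP => [-> | /eqP/dot_nondeg[w w1]].
  rewrite (eq_bigr (fun=> 1)) => [|xi _]; last by rewrite /chi dot0l eqxx.
  by rewrite sumr_const natz.
suff: \sum_xi chi xi v = - \sum_xi chi xi v by lia.
rewrite [LHS](reindex_inj (can_inj (addvK2 w))) -sumrN /=.
apply: eq_bigr => xi _; rewrite /chi dotC dotDl w1 dotC.
by case: (F2P (dot v xi)) => ->.
Qed.

Definition fourier A xi : int := \sum_(a in A) chi xi a.

Lemma fourier0 A : fourier A 0 = #|A|%:Z.
Proof.
rewrite /fourier (eq_bigr (fun=> 1)) ?sumr_const ?natz // => a _.
by rewrite /chi dotC dot0l eqxx.
Qed.

(** Parseval: by orthogonality only the pairs with [a + b = 0], that is [a = b], contribute. *)
Lemma sum_fourier2 A : \sum_xi fourier A xi ^+ 2 = (#|{: V}| * #|A|)%N%:Z.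
Proof.
transitivity (\sum_(a in A) \sum_(b in A) \sum_xi chi xi (a + b)).
  rewrite (eq_bigr (fun xi => \sum_(a in A) \sum_(b in A) chi xi (a + b))).
    by rewrite exchange_big; apply: eq_bigr => a _; rewrite exchange_big.
  move=> xi _; rewrite expr2 /fourier mulr_suml; apply: eq_bigr => a _.
  by rewrite mulr_sumr; apply: eq_bigr => b _; rewrite chiD.
rewrite (eq_bigr (fun=> #|{: V}|%:Z)) => [|a aA].
  by rewrite sumr_const -mulr_natr natz.
rewrite (bigD1 a) //= sum_chi addvv2 eqxx big1 ?addr0 // => b /andP[_ ba].
rewrite sum_chi; case: eqP => // ab0; case/eqP: ba.
by rewrite -[b](addvK2 a) ab0 addr0.
Qed.

Definition sum_free A := forall a b, a \in A -> b \in A -> a + b \notin A.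

(** By orthogonality the third moment is |V| times the number of triples of [A] with
    [a + b + c = 0], which in characteristic two means [a + b = c]. *)
Lemma sum_fourier3 A : sum_free A -> \sum_xi fourier A xi ^+ 3 = 0.
Proof.
move=> sfA.
transitivity (\sum_(a in A) \sum_(b in A) \sum_(c in A) \sum_xi chi xi (a + b + c)).
  rewrite (eq_bigr (fun xi =>
    \sum_(a in A) \sum_(b in A) \sum_(c in A) chi xi (a + b + c))).
    rewrite exchange_big; apply: eq_bigr => a _.
    by rewrite exchange_big; apply: eq_bigr => b _; rewrite exchange_big.
  move=> xi _; rewrite exprS expr2 {1}/fourier mulr_suml; apply: eq_bigr => a _.
  rewrite {1}/fourier mulr_suml mulr_sumr; apply: eq_bigr => b _.
  rewrite /fourier !mulr_sumr; apply: eq_bigr => c _.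
  by rewrite !chiD mulrA.
apply: big1 => a aA; apply: big1 => b bA; apply: big1 => c cA.
rewrite sum_chi; case: eqP => // abc.
by have := sfA _ _ aA bA; rewrite -[a + b](addvK2 c) addrC [c + _]addrC abc add0r cA.
Qed.

Lemma fourier_split A xi :
  fourier A xi = #|A :&: hyp xi|%:Z - #|A :\: hyp xi|%:Z.
Proof.
rewrite /fourier (big_setID (hyp xi)) /=.
rewrite (eq_bigr (fun=> 1)) => [|a]; last by rewrite !inE /chi => /andP[_ ->].
rewrite [X in _ + X](eq_bigr (fun=> -1)) => [|a]; last first.
  by rewrite !inE /chi => /andP[/negbTE-> _].
by rewrite !sumr_const !natz mulNrn natz.
Qed.

(* The third moment of the Fourier transform of a sum-free set vanishes, so
   some nontrivial coefficient is at most [- |A|^2 / (|V| - |A|) < - |A| / 2]. *)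
Lemma sum_free_bias A : sum_free A -> (#|{: V}| < 3 * #|A|)%N ->
  exists2 xi, xi != 0 & 2 * fourier A xi < - #|A|%:Z.
Proof.
move=> sfA ltVA.
have [/exists_inP[xi xi0 ltxi] | /exists_inPn big] :=
  boolP [exists (xi | xi != 0), 2 * fourier A xi < - #|A|%:Z]; first by exists xi.
have := sum_fourier2 A; have := sum_fourier3 sfA.
rewrite (bigD1 0) //= [X in _ -> X = _ -> _](bigD1 0) //= fourier0 => S3 S2.
(* If no coefficient is biased enough, each factor [2 * fourier A xi + #|A|] is nonnegative; but the
   two moments give this sum the negative value |A|^2 (|V| - 3 |A|). *)
have : 0 <= \sum_(xi : V | xi != 0)
    (2 * fourier A xi ^+ 3 + #|A|%:Z * fourier A xi ^+ 2).
  apply: sumr_ge0 => xi /big; rewrite -leNgt => le_xi.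
  rewrite (_ : _ + _ = (2 * fourier A xi + #|A|%:Z) * fourier A xi ^+ 2); last by ring.
  by apply: mulr_ge0; [rewrite -lerBlDr sub0r | apply: sqr_ge0].
rewrite big_split /= -!mulr_sumr.
have [A0 | Agt0] := posnP #|A|; first by rewrite A0 muln0 in ltVA.
set s3 := \sum_(xi | _) _ ^+ 3 in S3 *; set s2 := \sum_(xi | _) _ ^+ 2 in S2 *.
have -> : s3 = - #|A|%:Z ^+ 3 by rewrite -[s3](addKr (#|A|%:Z ^+ 3)) S3 addr0.
have -> : s2 = (#|{: V}| * #|A|)%N%:Z - #|A|%:Z ^+ 2.
  by rewrite -[s2](addKr (#|A|%:Z ^+ 2)) S2 addrC.
rewrite (_ : _ + _ = #|A|%:Z ^+ 2 * (#|{: V}|%:Z - 3 * #|A|%:Z)); last first.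
  by rewrite PoszM; ring.
by rewrite pmulr_rge0 ?exprn_gt0 //; lia.
Qed.

(** The bias means that the part [Q] of [A] off the hyperplane satisfies 4 |Q| > 3 |A| > |V|. An
    element [h] of [A] on the hyperplane would make [Q] and [h + Q] disjoint, both off the
    hyperplane, where there is room for only |V| / 2 vectors. *)
Lemma sum_free_hyperplane A : sum_free A -> (#|{: V}| < 3 * #|A|)%N ->
  exists2 xi, xi != 0 & forall a, a \in A -> dot a xi != 0.
Proof.
move=> sfA ltVA; have [xi xi0 bias] := sum_free_bias sfA ltVA.
exists xi => // h hA; apply/negP => h0.
rewrite fourier_split in bias; have := cardsID (hyp xi) A; set Q := A :\: _ in bias *.
have disj : [disjoint Q & [set h + a | a in Q]].
  rewrite disjoint_subset; apply/subsetP=> x; rewrite !inE => /andP[_ xA].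
  apply/imsetP => -[y]; rewrite inE => /andP[_ yA] xE.
  by have := sfA _ _ hA yA; rewrite -xE xA.
have sub : Q :|: [set h + a | a in Q] \subset ~: hyp xi.
  rewrite subUset; apply/andP; split; apply/subsetP=> x.
    by rewrite !inE => /andP[].
  case/imsetP=> y; rewrite !inE => /andP[yxi _] ->.
  by rewrite dotDl (eqP h0) add0r.
have [_] := card_hyp xi0; have := subset_leq_card sub.
move: disj; rewrite -leq_card_setU => /eqP->.
rewrite card_imset; last exact: (can_inj (addvK2 h)).
move: ltVA bias; move: #|Q| #|~: hyp xi| #|A :&: _| #|A| #|{: V}| => q c p a N.
by clear; lia.
Qed.

End Characters.

(** * Dense sets of vectors without large punctured subspaces *)

Section DenseSets.
Variable r : nat.
Local Notation V := 'rV['F_2]_r.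
Implicit Types (v w xi : V) (K U : {vspace V}) (E Q S : {set V}).

Definition punctured_sub U E := forall v, v \in U -> v != 0 -> v \in E.

(** The vector form of PG(d-1,2)-freeness: [d] is the linear dimension, one more than the projective
    one. *)
Definition geometry_free d E := forall U, \dim U = d -> ~ punctured_sub U E.

Arguments geometry_free d%_nat_scope E.

(** Since [v = (v + u) + u], the translates of [Q] by [K] cover [S]. This turns statements that
    cosets meet the complement of [E] into lower bounds for that complement. *)
Lemma card_shift_cover S Q K :
  (forall v, v \in S -> exists2 u, u \in K & v + u \in Q) ->
  (#|S| <= 2 ^ \dim K * #|Q|)%N.
Proof.
move=> cover; have -> : (2 ^ \dim K = #|[set u in K]|)%N.
  by rewrite cardsE card_vspace card_Fp.
rewrite -cardsX; apply: leq_trans (leq_imset_card (fun p : V * V => p.2 + p.1) _).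
apply/subset_leq_card/subsetP=> v /cover[u uK vuQ].
apply/imsetP; exists (u, v + u); first by rewrite !inE uK.
by rewrite /= -addrA addvv2 addr0.
Qed.

Lemma memv_add_line K w v :
  v \in (K + <[w]>)%VS -> exists2 u, u \in K & v = u \/ v = u + w.
Proof.
case/memv_addP=> u uK [_ /vlineP[c ->] ->]; exists u => //.
by case: (F2P c) => ->; [left; rewrite scale0r addr0 | right; rewrite scale1r].
Qed.

Lemma dim_add_line K w : w \notin K -> \dim (K + <[w]>) = (\dim K).+1.
Proof.
move=> wK; rewrite dimv_disjoint_sum.
  by rewrite dim_vline (_ : w != 0) ?addn1 //; apply: contraNneq wK => ->; apply: mem0v.
apply/eqP; rewrite -subv0; apply/subvP=> v; rewrite memv_cap memv0.
case/andP=> vK /vlineP[c vE]; case: (F2P c) vE => ->; first by rewrite scale0r => ->.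
by rewrite scale1r => vw; rewrite -vw vK in wK.
Qed.

Lemma punctured_add_line K E w : punctured_sub K E ->
  (forall u, u \in K -> w + u \in E) -> punctured_sub (K + <[w]>)%VS E.
Proof.
move=> KE wKE v /memv_add_line[u uK [-> | ->]]; first exact: KE.
by move=> _; rewrite addrC; apply: wKE.
Qed.

(** The coset [K] itself contains 0, which is not in [E]; any other coset inside [E] would extend
    [K] to a punctured subspace of one dimension more. *)
Lemma coset_missed E K v : 0 \notin E -> geometry_free (\dim K).+1 E ->
  punctured_sub K E -> exists2 u, u \in K & v + u \in ~: E.
Proof.
move=> E0 freeE KE; have [vK | vK] := boolP (v \in K).
  by exists v; rewrite // inE addvv2.
have [/exists_inP[u uK vuE] | /exists_inPn vKE] :=
  boolP [exists u in K, v + u \in ~: E]; first by exists u.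
case: (freeE _ (dim_add_line vK)); apply: punctured_add_line => // u uK.
by have := vKE _ uK; rewrite inE negbK.
Qed.

(* Modulo [K], this is what remains of [E] when [K] is contracted. *)
Definition thick E K := [set v | [forall u in K, v + u \in E]].

Lemma thickP E K v : reflect (forall u, u \in K -> v + u \in E) (v \in thick E K).
Proof. by rewrite inE; apply: forall_inP. Qed.

Lemma thick_shift E K v u : u \in K -> (v + u \in thick E K) = (v \in thick E K).
Proof.
move=> uK; apply/thickP/thickP=> vKE w wK.
  by rewrite -[w](addvK2 u) addrA; apply: vKE; apply: memvD.
by rewrite -addrA; apply: vKE; apply: memvD.
Qed.

Lemma thick_add_line E K w v :
  (v \in thick E (K + <[w]>)%VS) = (v \in thick E K) && (v + w \in thick E K).
Proof.
apply/thickP/andP=> [vKE | [/thickP vKE /thickP vwKE] u].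
  split; apply/thickP=> u uK; first by apply: vKE; apply: subvP uK; apply: addvSl.
  by rewrite -addrA [w + u]addrC; apply: vKE; apply: memv_add (memv_line w).
case/memv_add_line=> {}u uK [-> | ->]; first exact: vKE.
by rewrite [u + w]addrC addrA; apply: vwKE.
Qed.

Lemma card_thickC E K : (#|~: thick E K| <= 2 ^ \dim K * #|~: E|)%N.
Proof.
apply: card_shift_cover => v; rewrite !inE negb_forall_in.
by case/exists_inP=> u uK vuE; exists u; rewrite // inE.
Qed.

(** If [v], [w] and [v + w] were all thick, then [K + <[w]>] would be a punctured subspace of [E] of
    dimension [(\dim K).+1] whose coset through [v] lies in [E], against [coset_missed]. *)
Lemma thick_sum_free E K : 0 \notin E -> geometry_free (\dim K).+2 E ->
  punctured_sub K E -> sum_free (thick E K).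
Proof.
move=> E0 freeE KE v w vK wK; apply/negP=> vwK.
have wNK : w \notin K.
  apply: contra E0 => wK0; rewrite -(addvv2 w).
  by move/thickP: wK; apply.
have [|||u uU] := @coset_missed E (K + <[w]>)%VS v => //.
- by rewrite dim_add_line.
- by apply: punctured_add_line => //; apply/thickP.
have /thickP vU : v \in thick E (K + <[w]>)%VS by rewrite thick_add_line vK vwK.
by rewrite inE vU.
Qed.

(** For nonzero [w], each pair of difference [w] inside [S] is counted at both ends. With
    [S = thick E K] this set is [thick E (K + <[w]>)]. *)
Definition chords S w := [set v in S | v + w \in S].

(* Of four vectors at most three lie in [S], and [C(j, 2) >= 2 j - 3] for
   [j <= 3]. *)
Lemma card_chords S x y :
  (forall v, ~~ [&& v \in S, v + x \in S, v + y \in S & v + (x + y) \in S]) ->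
  (8 * #|S| <= 3 * #|{: V}| +
     2 * (#|chords S x| + #|chords S y| + #|chords S (x + y)%R|))%N.
Proof.
pose z := x + y => Sxy; pose b w v : nat := v + w \in S.
have shiftS w : (\sum_v b w v = #|S|)%N.
  rewrite -sum1_card [RHS]big_mkcond [RHS](reindex_inj (addIr w)) /=.
  by apply: eq_bigr => v _; rewrite /b; case: (_ \in S).
have pairS u w t : u + w = t ->
  (\sum_v b u v * b t v = #|chords S w|)%N.
  move=> <-; rewrite -sum1_card [RHS]big_mkcond [RHS](reindex_inj (addIr u)) /=.
  by apply: eq_bigr => v _; rewrite /b inE addrA; do 2!case: (_ \in S).
(* The six pairs are grouped by difference: each of [x], [y], [z] occurs twice, whence the factor 2
   in the bound. *)
have : (\sum_v 2 * (b 0%R v + b x v + b y v + b z v) <=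
  \sum_(v : V) (3 + ((b 0%R v * b x v + b y v * b z v) +
    (b 0%R v * b y v + b x v * b z v) + (b 0%R v * b z v + b x v * b y v))))%N.
  apply: leq_sum => v _; have := Sxy v; rewrite -/z /b addr0.
  by case: (v \in S); case: (v + x \in S); case: (v + y \in S); case: (v + z \in S).
rewrite -big_distrr !big_split /= !shiftS sum_nat_const.
rewrite (pairS 0 x) ?add0r // (pairS y x) 1?[y + x]addrC // (pairS 0 y) ?add0r //.
rewrite (pairS x y) // (pairS 0 z) ?add0r // (pairS x z) ?addvK2 // -/z.
by move: #|chords S x| #|chords S y| #|chords S z| #|S| #|{: V}|; clear; lia.
Qed.

Lemma card_rV2 : (#|{: V}| = 2 ^ r)%N.
Proof. by rewrite card_mx card_Fp // mul1n. Qed.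

(* Count [~: E] by cosets of [K] inside [hyp xi] and by cosets of a putative
   forbidden subspace [U] outside. *)
Lemma hyp_missed E n xi : (2 <= n <= r)%N -> 0 \notin E -> geometry_free n E ->
  (#|~: E| < 3 * 2 ^ (r - n))%N -> xi != 0 ->
  forall K, \dim K = n.-2 -> thick E K != set0 ->
  (forall v, v \in thick E K -> v \notin hyp xi) ->
  geometry_free n.-1 (E :&: hyp xi).
Proof.
case/andP=> n2 nr E0 freeE ltE xi0 K dK /set0Pn[a aK] thickH U dU UE.
(* [a] and [a + u] are both thick, so both lie off the hyperplane and their sum [u] lies on it. *)
have KH u : u \in K -> dot u xi = 0.
  move=> uK; move: (thickH (a + u)) (thickH a aK); rewrite thick_shift // => /(_ aK).
  rewrite /hyp !inE dotDl.
  by case: (F2P (dot a xi)) => ->; case: (F2P (dot u xi)) => ->.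
have UH u : u \in U -> dot u xi = 0.
  have [-> | u0] := eqVneq u 0; first by rewrite dot0l.
  by move=> /UE/(_ u0); rewrite !inE => /andP[_ /eqP].
have inH : (#|hyp xi| <= 2 ^ \dim K * #|~: E :&: hyp xi|)%N.
  apply: card_shift_cover => v vH.
  have : v \notin thick E K by apply/negP=> /thickH; rewrite vH.
  rewrite inE negb_forall_in => /exists_inP[u uK vuE]; exists u => //.
  by rewrite !inE vuE dotDl (KH u uK) addr0; rewrite inE in vH.
have outH : (#|~: hyp xi| <= 2 ^ \dim U * #|~: E :\: hyp xi|)%N.
  apply: card_shift_cover => v vH.
  have [|||u uU vuE] := @coset_missed E U v => //.
  - by by rewrite dU prednK // ltnW.
  - by move=> u /UE uE /uE; rewrite inE => /andP[].
  exists u => //; rewrite 2!inE vuE andbT.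
  by move: vH; rewrite !inE dotDl (UH u uU) addr0.
have [c1 c2] := card_hyp xi0; have cE := cardsID (hyp xi) (~: E).
have c2r : (2 ^ r = 4 * (2 ^ n.-2 * 2 ^ (r - n)))%N.
  by rewrite -(expnD 2) -(expnD 2 2); congr (2 ^ _)%N; lia.
rewrite dK in inH; rewrite dU (_ : n.-1 = n.-2.+1) ?expnS in outH; last by lia.
rewrite card_rV2 c2r in c1 c2.
have m0 : (0 < 2 ^ n.-2)%N by rewrite expn_gt0.
(* The hyperplane consists of 2^(r-1) / 2^(n-2) cosets of [K], its complement of 2^(r-1) / 2^(n-1)
   cosets of [U]; each contains a vector missing from [E]. *)
have : (2 * 2 ^ (r - n) <= #|~: E :&: hyp xi|)%N.
  by rewrite -(leq_pmul2l m0); move: c1 inH; clear; lia.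
have : (2 ^ (r - n) <= #|~: E :\: hyp xi|)%N.
  by rewrite -(leq_pmul2l m0); move: c2 outH; clear; lia.
move: cE ltE; move: (2 ^ (r - n))%N #|_ :&: _| #|_ :\: _| #|~: E|.
by clear; lia.
Qed.

Lemma dense_hyperplane E n : (3 <= n <= r)%N -> 0 \notin E -> geometry_free n E ->
  (#|~: E| < 3 * 2 ^ (r - n))%N ->
  exists2 xi, xi != 0 & geometry_free n.-1 (E :&: hyp xi).
Proof.
case: n => [|[|[|n]]] // nr E0 freeE ltE.
(* From here on [n] is the original value minus 3. Quantifying over bases instead of subspaces makes
   the alternative a finite one. *)
have [/existsP[X /andP[]] | noX] := boolP [exists X : n.+2.-tuple V,
    free X && [forall v, (v \in <<X>>%VS) ==> (v != 0) ==> (v \in E)]]; last first.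
  (* Without a punctured subspace of dimension [n.+2] in [E], any hyperplane will do. *)
  have [xi xi0] : exists xi : V, xi != 0.
    exists (const_mx 1); apply/rV0Pn; case: r nr => // r' _; exists 0.
    by rewrite mxE.
  exists xi => // U dU UE; case/existsP: noX.
  rewrite /= in dU; have : basis_of U (vbasis U) := vbasisP U.
  move: (vbasis U); rewrite dU => X bX; exists X; rewrite (basis_free bX).
  rewrite (span_basis bX); apply/forallP=> v; apply/implyP=> vU; apply/implyP=> v0.
  by have := UE v vU v0; rewrite inE => /andP[].
case/tupleP: X => x X; case/tupleP: X => y X; rewrite /= !free_cons.
case/and3P=> xX yX freeX /forallP XE.
set K0 := <<X>>%VS in yX.
have dK0 : \dim K0 = n by rewrite /K0 (eqP freeX) size_tuple.
have UE : punctured_sub (K0 + <[y]> + <[x]>)%VS E.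
  move=> v; rewrite addvC [(K0 + _)%VS]addvC -!span_cons => vU v0.
  by have := XE v; rewrite vU v0.
have xK0 : x \notin K0.
  by apply: contra xX; apply: subvP; rewrite span_cons addvSr.
have xyK0 : x + y \notin K0.
  apply: contra xX => xyK0; rewrite span_cons -[x](addvK2 y) [y + x]addrC.
  by apply: memv_add xyK0; apply: memv_line.
have chordE w : thick E (K0 + <[w]>)%VS = chords (thick E K0) w.
  by apply/setP=> v; rewrite thick_add_line [in RHS]inE.
(* Four thick cosets of [K0] here would form a whole coset of [K0 + <[y]> + <[x]>] inside [E]. *)
have few v : ~~ [&& v \in thick E K0, v + x \in thick E K0, v + y \in thick E K0
                 & v + (x + y) \in thick E K0].
  apply/negP=> /and4P[v00 v10 v01 v11].
  have vU : v \in thick E (K0 + <[y]> + <[x]>)%VS.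
    by rewrite !thick_add_line v00 v01 v10 -addrA v11.
  have [|||u uU] := @coset_missed E (K0 + <[y]> + <[x]>)%VS v => //.
  - by rewrite !dim_add_line ?dK0 // addvC -span_cons.
  by rewrite inE (thickP _ _ _ vU).
(* Fewer than 2^n * 3 * 2^(r-n-3) = 3/8 |V| vectors are not thick, so [card_chords] gives 5 |V| < 3
   |V| + 2 (sum of the three chord counts). *)
have big : (#|{: V}| < #|chords (thick E K0) x| + #|chords (thick E K0) y| +
   #|chords (thick E K0) (x + y)|)%N.
  have := card_chords few; have := card_thickC E K0; have := cardsC (thick E K0).
  rewrite dK0 card_rV2 (_ : 2 ^ r = 8 * (2 ^ n * 2 ^ (r - n.+3)))%N; last first.
    by rewrite -(expnD 2) -(expnD 2 3); congr (2 ^ _)%N; lia.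
  have m0 : (0 < 2 ^ n)%N by rewrite expn_gt0.
  have : (2 ^ n * #|~: E| < 2 ^ n * (3 * 2 ^ (r - n.+3)))%N by rewrite ltn_pmul2l.
  move: #|chords _ x| #|chords _ y| #|chords _ (x + y)%R| #|thick _ _| #|~: thick _ _|.
  by move: #|~: E| (2 ^ n)%N (2 ^ (r - n.+3))%N m0; clear; nia.
have xU : x \in (K0 + <[y]> + <[x]>)%VS.
  by apply: subvP (addvSr _ _) _ (memv_line x).
have yU : y \in (K0 + <[y]> + <[x]>)%VS.
  by apply: subvP (addvSl _ _) _ (subvP (addvSr _ _) _ (memv_line y)).
(* Pigeonhole over the three directions [x], [y], [x + y], which give the three intermediate
   subspaces. *)
have [w [wK0 wU bigw]] : exists w, [/\ w \notin K0, w \in (K0 + <[y]> + <[x]>)%VS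
    & (#|{: V}| < 3 * #|thick E (K0 + <[w]>)%VS|)%N].
  have /or3P[] : [|| #|{: V}| < 3 * #|chords (thick E K0) x|,
      #|{: V}| < 3 * #|chords (thick E K0) y|
    | #|{: V}| < 3 * #|chords (thick E K0) (x + y)%R|]%N.
    move: big; move: #|chords _ x| #|chords _ y| #|chords _ (x + y)%R| #|{: V}|.
    by clear; lia.
  - by exists x; rewrite chordE.
  - by exists y; rewrite chordE.
  - by exists (x + y); rewrite chordE xyK0 memvD.
have KU : (K0 + <[w]> <= K0 + <[y]> + <[x]>)%VS.
  by rewrite subv_add -memvE wU andbT; apply: subv_trans (addvSl _ _) (addvSl _ _).
have KE : punctured_sub (K0 + <[w]>)%VS E.
  by move=> v vK; apply: UE; apply: subvP vK.
have dK : \dim (K0 + <[w]>) = n.+1 by rewrite dim_add_line ?dK0.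
have [|xi xi0 Axi] := @sum_free_hyperplane _ (thick E (K0 + <[w]>)%VS) _ bigw.
  by apply: thick_sum_free => //; rewrite dK.
exists xi => //; apply: (@hyp_missed E n.+3 xi _ _ _ _ _ (K0 + <[w]>)%VS) => //.
- by apply/set0Pn/card_gt0P; move: bigw; case: #|thick _ _|.
- by move=> v /Axi; rewrite inE.
Qed.

(* For [n = 3] the set [E :&: hyp xi] is sum-free, hence fills at most half of
   any subspace containing it. *)
Lemma dense_hyp_span E n xi U : (3 <= n <= r)%N -> 0 \notin E ->
  (#|~: E| < 3 * 2 ^ (r - n))%N -> xi != 0 ->
  geometry_free n.-1 (E :&: hyp xi) ->
  (forall v, v \in E :&: hyp xi -> v \in U) -> (r <= (\dim U).+1)%N.
Proof.
set S := E :&: hyp xi => /andP[n3 nr] E0 ltE xi0 freeS SU.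
rewrite leqNgt; apply/negP=> ltU.
have leU : (#|U| <= 2 ^ (r - 2))%N.
  rewrite card_vspace card_Fp // leq_exp2l //.
  by move: ltU; move: (\dim U); clear; lia.
have S0 : 0 \notin S by rewrite inE (negbTE E0).
have leS : (#|S| <= #|U|)%N by apply/subset_leq_card/subsetP.
have [cH _] := card_hyp xi0; have := cardsID E (hyp xi); rewrite setIC -/S => cS.
have : (#|hyp xi :\: E| <= #|~: E|)%N by rewrite setDE subset_leq_card ?subsetIr.
rewrite card_rV2 (_ : 2 ^ r = 4 * 2 ^ (r - 2))%N in cH; last first.
  by rewrite -(expnD 2 2); congr (2 ^ _)%N; lia.
(* For [n] at least 4, fewer than 3/4 * 2^(r-2) vectors are missing from a hyperplane of size 2 *
   2^(r-2), so [S] is already larger than [U]. *)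
case: n n3 nr ltE freeS => [|[|[|[|n]]]] // _ nr ltE freeS leHE; last first.
  have : (4 * 2 ^ (r - n.+4) <= 2 ^ (r - 2))%N.
    by rewrite -(expnD 2 2) leq_exp2l //; lia.
  move: ltE cS cH leS leU leHE; move: #|E| #|S| #|~: E| #|U| #|hyp xi| #|_ :\: _|.
  by move: (2 ^ (r - n.+4))%N (2 ^ (r - 2))%N; clear; lia.
have sfS : sum_free S.
  have -> : S = thick S 0%VS.
    apply/setP=> v; apply/idP/thickP => [vS u | /(_ 0 (mem0v _))].
      by rewrite memv0 => /eqP->; rewrite addr0.
    by rewrite addr0.
  apply: thick_sum_free; rewrite ?dimv0 // => v.
  by rewrite memv0 => /eqP->; rewrite eqxx.
have r2 : (2 ^ (r - 2) = 2 * 2 ^ (r - 3))%N.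
  by rewrite -expnS; congr (2 ^ _)%N; lia.
have [S_0 | [a aS]] := set_0Vmem S.
  rewrite S_0 cards0 in cS; move: ltE cS cH leHE r2;
  move: #|hyp xi| #|~: E| #|_ :\: _|.
  by move: (2 ^ (r - 3))%N (2 ^ (r - 2))%N; clear; lia.
(* For [n = 3] fewer than 3 * 2^(r-3) vectors are missing, so |S| > 2^(r-3); two disjoint copies of
   [S] then overfill [U], which has at most 2^(r-2) elements. *)
have disj : [disjoint S & [set a + s | s in S]].
  rewrite disjoint_subset; apply/subsetP=> x xS; apply/imsetP => -[s sS xE].
  by have := sfS _ _ aS sS; rewrite -xE xS.
have /subset_leq_card : S :|: [set a + s | s in S] \subset U.
  apply/subsetP=> x; rewrite inE => /orP[/SU // |].
  by case/imsetP=> s sS ->; apply: memvD; apply: SU.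
move: disj; rewrite -leq_card_setU => /eqP->.
rewrite card_imset; last exact: (can_inj (addvK2 a)).
move: ltE cS cH leHE r2 leU; move: #|U| #|S| #|hyp xi| #|~: E| #|_ :\: _|.
by move: (2 ^ (r - 3))%N (2 ^ (r - 2))%N; clear; lia.
Qed.

End DenseSets.

(** * Injective linear maps and coordinates on a subspace *)

Section LinearMaps.
Variables (F : fieldType) (aT vT : vectType F).

Lemma free_map_lker0 (g : 'Hom(aT, vT)) (s : seq aT) :
  lker g == 0%VS -> free [seq g x | x <- s] = free s.
Proof.
move=> /eqP g0; rewrite /free -limg_span limg_dim_eq ?size_map //.
by rewrite g0 capv0.
Qed.

Lemma exists_coordinates (U : {vspace vT}) d : \dim U = d ->
  exists g : 'Hom('rV[F]_d, vT), lker g == 0%VS /\ limg g = U.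
Proof.
move=> <-; pose e := vbasis U.
have lin : linear (fun v : 'rV[F]_(\dim U) => \sum_i v 0 i *: e`_i).
  move=> c u v; rewrite scaler_sumr -big_split; apply: eq_bigr => i _.
  by rewrite /= !mxE scalerDl scalerA.
pose comb := fun v : 'rV[F]_(\dim U) => \sum_i v 0 i *: e`_i.
pose gL : {linear 'rV[F]_(\dim U) -> vT} :=
  HB.pack comb (GRing.isLinear.Build F _ vT *:%R comb lin).
have gE v : linfun gL v = \sum_i v 0 i *: e`_i by rewrite lfunE.
exists (linfun gL); split.
  apply/lker0P=> u v; rewrite !gE => uv; apply/rowP=> i.
  have /freeP/(_ (fun i => u 0 i - v 0 i)) := basis_free (vbasisP U).
  move=> free_e; apply/eqP; rewrite -subr_eq0 free_e //.
  by under eq_bigr do rewrite scalerBl; rewrite sumrB uv subrr.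
apply/vspaceP=> w; apply/idP/idP => [/memv_imgP[v _ ->] | wU].
  rewrite gE; apply: memv_suml => i _; apply: memvZ.
  by apply: vbasis_mem; apply: mem_nth; rewrite size_tuple.
rewrite (coord_vbasis wU); apply/memv_imgP.
exists (\row_i coord e i w); first exact: memvf.
by rewrite gE; apply: eq_bigr => i _; rewrite mxE.
Qed.

End LinearMaps.

Local Close Scope ring_scope.

(** * Vector representations of matroids *)

Section Representations.
Variable T : finType.
Implicit Types (M N : matroid T) (X L I : {set T}).

Definition represents (F : fieldType) (vT : vectType F) M (f : T -> vT) :=
  forall I, I \subset ground M -> indep M I = free [seq f x | x <- enum I].

Definition image_span (F : fieldType) (vT : vectType F) (f : T -> vT) X :=
  <<[seq f x | x <- enum X]>>%VS.

Lemma mem_image_span (F : fieldType) (vT : vectType F) (f : T -> vT) X x :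
  x \in X -> f x \in image_span f X.
Proof. by move=> xX; apply: memv_span; apply: map_f; rewrite mem_enum. Qed.

Lemma image_span_subP (F : fieldType) (vT : vectType F) (f : T -> vT) X (U : {vspace vT}) :
  (forall x, x \in X -> f x \in U) -> (image_span f X <= U)%VS.
Proof.
move=> XU; apply/span_subvP=> _ /mapP[x xX ->].
by apply: XU; rewrite mem_enum in xX.
Qed.

Lemma enum_setU1 x X : x \notin X -> perm_eq (enum (x |: X)) (x :: enum X).
Proof.
move=> xX; apply: uniq_perm; rewrite /= ?mem_enum ?xX ?enum_uniq // => y.
by rewrite mem_enum !inE mem_enum.
Qed.

(** An independent subset of [X] of maximal size already spans, since an element mapped outside its
    span could be added. *)
Lemma mrank_image_span (F : fieldType) (vT : vectType F) M (f : T -> vT) X :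
  represents M f -> X \subset ground M -> mrank M X = \dim (image_span f X).
Proof.
move=> repf XM; apply/eqP; rewrite eqn_leq; apply/andP; split.
  apply/bigmax_leqP=> I /andP[IX]; rewrite repf ?(subset_trans IX) // => /eqP.
  rewrite size_map -cardE => <-; apply: dimvS; apply: image_span_subP => x xI.
  by apply: mem_image_span; apply: subsetP xI.
pose P I := (I \subset X) && indep M I.
have P0 : P set0 by rewrite /P sub0set indep0.
case: (@arg_maxnP _ set0 P (fun I => #|I|) P0) => I /andP[IX iI] maxI.
apply: leq_trans (leq_bigmax_cond (F := fun I : {set T} => #|I|) I _); last by rewrite IX.
have freeI := iI; rewrite repf ?(subset_trans IX) // in freeI.
rewrite cardE -(size_map f) -(eqP freeI); apply: dimvS; apply: image_span_subP => x xX.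
have [xI | xI] := boolP (x \in I); first exact: mem_image_span.
apply: contraT => xspan; have /maxI : P (x |: I).
  rewrite /P subUset sub1set xX IX repf; last first.
    by rewrite subUset sub1set (subsetP XM) // (subset_trans IX).
  by rewrite (perm_free (perm_map f (enum_setU1 xI))) /= free_cons xspan.
by rewrite /= cardsU1 xI ltnn.
Qed.

Lemma represents_restrict (F : fieldType) (vT : vectType F) M (f : T -> vT) L :
  represents M f -> represents (restrict M L) f.
Proof.
move=> repf I; rewrite subsetI => /andP[IM IL].
by rewrite -[LHS]/((I \subset L) && indep M I) IL repf.
Qed.

(** The given representation may live in a space of any dimension; coordinates on the span of its
    image bring it down to the rank. *)
Lemma binary_coordinates M : binary M ->
  exists f : T -> 'rV['F_2]_(mrank M (ground M)), represents M f.
Proof.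
case=> m [f repf].
have [g [g0 gU]] := exists_coordinates (esym (mrank_image_span repf (subxx _))).
exists (fun x => (g^-1)%VF (f x)) => I IM; rewrite repf //.
rewrite -(free_map_lker0 _ g0) -map_comp; congr (free _).
apply/eq_in_map => x; rewrite mem_enum => xI /=.
by rewrite limg_lfunVK // gU; apply: mem_image_span; apply: subsetP xI.
Qed.

Lemma simple_indep M I : simple_matroid M -> I \subset ground M -> #|I| <= 2 -> indep M I.
Proof.
move=> simpleM IM leI; apply: contraT => dI.
have [C circC CI] := @minset_exists _ [pred X : {set T} | (X \subset ground M) && ~~ indep M X]
  I (introT andP (conj IM dI)).
by have := simpleM _ circC; rewrite ltnNge (leq_trans (subset_leq_card CI)).
Qed.

Lemma simple_represents_inj (F : fieldType) (vT : vectType F) M (f : T -> vT) :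
  simple_matroid M -> represents M f ->
  {in ground M &, injective f} /\ (forall x, x \in ground M -> f x != 0%R).
Proof.
move=> simpleM repf; split=> [x y xM yM fxy | x xM]; last first.
  have := simple_indep simpleM (I := [set x]); rewrite sub1set xM cards1 => /(_ isT isT).
  by rewrite repf ?sub1set // enum_set1 /= seq1_free.
apply: contraPeq fxy => xy.
have xyM : [set x; y] \subset ground M by rewrite subUset !sub1set xM.
have := simple_indep simpleM xyM; rewrite cards2 xy => /(_ isT).
rewrite repf // (perm_free (perm_map f (enum_setU1 _))) ?inE // enum_set1 /=.
by rewrite free_cons span_seq1 => /andP[fxy _] fE; rewrite fE memv_line in fxy.
Qed.

End Representations.

Lemma free_enum_imset (F : finFieldType) m (aT : finType) (h : aT -> 'rV[F]_m) (J : {set aT}) :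
  {in J &, injective h} -> free (enum (h @: J)) = free [seq h x | x <- enum J].
Proof.
move=> hinj; apply: perm_free; apply: uniq_perm; rewrite ?enum_uniq //.
  by rewrite map_inj_in_uniq ?enum_uniq // => x y; rewrite !mem_enum; apply: hinj.
move=> v; rewrite mem_enum; apply/imsetP/mapP => -[x xJ ->]; exists x => //;
  by rewrite mem_enum in xJ *.
Qed.

(** * Binary projective geometries as punctured subspaces *)

Section ProjectiveGeometries.
Variables (T : finType) (N : matroid T) (r d : nat) (f : T -> 'rV['F_2]_r).
Hypotheses (repf : represents N f) (finj : {in ground N &, injective f})
  (fn0 : forall x, x \in ground N -> f x != 0%R).

Lemma card_nonzero m (U : {vspace 'rV['F_2]_m}) :
  #|[set v in U | v != 0%R]| = (2 ^ \dim U).-1.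
Proof.
have := card_vspace U; rewrite card_Fp // => <-.
rewrite [RHS](_ : _ = #|[set v in U] :\ 0%R|); last first.
  by rewrite -(cardsE (mem U)) (cardsD1 0%R [set v in U]) inE mem0v.
by apply: eq_card => v; rewrite !inE andbC.
Qed.

(** Independent sets transported to [PG2 d] bound the rank by [d.+1]; the 2^(d+1) - 1 distinct
    nonzero images then force equality and fill the span. *)
Lemma geometry_of_iso : matroid_iso N (PG2 d) ->
  exists2 U : {vspace 'rV['F_2]_r}, \dim U = d.+1 & punctured_sub U (f @: ground N).
Proof.
case=> F [bijF indepF]; set U := image_span f (ground N).
have sub : f @: ground N \subset [set v in U | v != 0%R].
  apply/subsetP=> _ /imsetP[x xN ->].
  by rewrite inE fn0 // andbT; apply: mem_image_span.
have cardN : #|f @: ground N| = (2 ^ d.+1).-1.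
  rewrite card_in_imset //; have := bij_eq_card bijF; rewrite !card_sig.
  have -> : #|[pred x | x \in ground N]| = #|ground N| by apply: eq_card.
  move=> ->; have := card_nonzero {:'rV['F_2]_d.+1}.
  rewrite dimvf dim_matrix mul1r => <-.
  by apply: eq_card => v; rewrite !inE memvf.
have leU : \dim U <= d.+1.
  rewrite -(mrank_image_span repf (subxx _)); apply/bigmax_leqP=> I /andP[IN iI].
  pose I' := [set x : {x : T | x \in ground N} | val x \in I].
  have IE : [set val x | x in I'] = I.
    apply/setP=> x; apply/imsetP/idP => [[y] | xI]; first by rewrite inE => yI ->.
    by exists (Sub x (subsetP IN _ xI)); rewrite ?inE SubK.
  rewrite -IE indepF in iI; case/andP: iI => _ /eqP freeI.
  rewrite -IE (card_imset _ val_inj) -(card_imset _ (bij_inj bijF)).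
  rewrite -(card_imset _ val_inj) -imset_comp cardE -freeI.
  by rewrite (leq_trans (dimvS (subvf _))) // dimvf dim_matrix mul1r.
have dimU : \dim U = d.+1.
  apply/eqP; rewrite eqn_leq leU -(@leq_exp2l 2) //.
  have := subset_leq_card sub; rewrite card_nonzero cardN.
  have pos m : 0 < 2 ^ m by rewrite expn_gt0.
  by move: (pos d.+1) (pos (\dim U)); move: (2 ^ _) (2 ^ _) => a b; clear; lia.
exists U => // v vU v0; have /eqP -> : f @: ground N == [set v in U | v != 0%R].
  by rewrite eqEcard sub cardN card_nonzero dimU leqnn.
by rewrite inE vU.
Qed.

(** The isomorphism is [f] followed by a choice of coordinates on [U]. *)
Lemma iso_of_geometry (U : {vspace 'rV['F_2]_r}) : \dim U = d.+1 ->
  f @: ground N = [set v in U | v != 0%R] -> matroid_iso N (PG2 d).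
Proof.
case/exists_coordinates=> g [g0 gU] fU; have ginj := lker0P g0.
pose h x := (g^-1)%VF (f x).
have gh x : x \in ground N -> g (h x) = f x.
  move=> xN; rewrite limg_lfunVK // gU.
  by have := imset_f f xN; rewrite fU inE => /andP[].
have hN x : x \in ground N -> h x \in ground (PG2 d).
  move=> xN; rewrite inE; apply: contra (fn0 xN) => /eqP h0.
  by rewrite -gh // h0 linear0.
have hinj : {in ground N &, injective h}.
  by move=> x y xN yN hxy; apply: finj; rewrite // -!gh // hxy.
pose F (x : {x : T | x \in ground N}) : {y | y \in ground (PG2 d)} :=
  Sub (h (val x)) (hN _ (valP x)).
exists F; split=> [|I].
  have Finj : injective F.
    move=> x y /(congr1 val)/hinj xy.
    by apply: val_inj; apply: xy; apply: valP.
  apply: inj_card_bij Finj _; apply: leq_trans (leq_imset_card F predT).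
  apply/subset_leq_card/subsetP => y _.
  have : g (val y) \in f @: ground N.
    rewrite fU inE -gU memv_img ?memvf //=.
    have := valP y; rewrite inE; apply: contra => /eqP.
    by rewrite -(linear0 g) => /ginj/eqP.
  case/imsetP=> x xN gx; apply/imsetP; exists (Sub x xN) => //.
  by apply: val_inj; apply: ginj; rewrite gx -gh.
set J := [set val x | x in I].
have JN : J \subset ground N by apply/subsetP=> _ /imsetP[x _ ->]; apply: valP.
have -> : [set val (F x) | x in I] = h @: J.
  by rewrite -imset_comp; apply: eq_imset.
have hJN : h @: J \subset ground (PG2 d).
  by apply/subsetP=> _ /imsetP[x xJ ->]; exact: (hN x (subsetP JN x xJ)).
rewrite -[RHS]/((h @: J \subset ground (PG2 d)) && free (enum (h @: J))) hJN.
rewrite repf // free_enum_imset; last first.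
  by move=> x y /(subsetP JN) xN /(subsetP JN); apply: hinj.
rewrite -(free_map_lker0 _ g0) -map_comp; congr (free _).
by apply/eq_in_map => x; rewrite mem_enum => /(subsetP JN)/gh.
Qed.

End ProjectiveGeometries.

(** Moving the deficiency to the right keeps the natural-number form free of truncated subtraction
    from 2^r. *)
Lemma density_nat n r N : n <= r ->
  ((1 - 3 / 2 ^+ n) * 2 ^+ r < N%:R :> rat)%R = (2 ^ r < N + 3 * 2 ^ (r - n)).
Proof.
move=> le_nr; rewrite -(ltr_nat rat) natrD natrM !natrX -ltrBlDr.
suff -> : ((1 - 3 / 2 ^+ n) * 2 ^+ r = 2 ^+ r - 3 * 2 ^+ (r - n) :> rat)%R by [].
have n0 : (2 ^+ n : rat)%R != 0%R by rewrite expf_neq0.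
have -> : (2 ^+ r = 2 ^+ n * 2 ^+ (r - n) :> rat)%R by rewrite -exprD subnKC.
by rewrite mulrBl mul1r [(3 / _ * _)%R]mulrA divfK.
Qed.

(** * Transfer between the matroid and its set of vectors *)

Section HyperplaneOfMatroid.
Variables (T : finType) (M : matroid T) (r : nat) (f : T -> 'rV['F_2]_r).
Hypotheses (simpleM : simple_matroid M) (repf : represents M f).

Lemma matroid_free_geometry d :
  matroid_free (PG2 d) M -> geometry_free d.+1 (f @: ground M).
Proof.
have [finj fn0] := simple_represents_inj simpleM repf.
move=> freeM U dU UE; apply: freeM.
pose X := [set x in ground M | f x \in U].
have XE : ground (restrict M X) = X.
  by apply/setP=> x; rewrite !inE andbA andbb.
exists X; first by apply/subsetP=> x; rewrite inE => /andP[].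
apply: (iso_of_geometry (represents_restrict repf) _ _ dU); rewrite XE.
- by move=> x y; rewrite !inE => /andP[xM _] /andP[yM _]; apply: finj.
- by move=> x; rewrite inE => /andP[xM _]; apply: fn0.
apply/setP=> v; rewrite inE; apply/imsetP/andP => [[x] | [vU v0]].
  by rewrite inE => /andP[xM xU] ->; split=> //; apply: fn0.
by case/imsetP: (UE v vU v0) => x xM vE; exists x => //; rewrite inE xM -vE.
Qed.

Lemma geometry_free_restrict d (L : {set T}) : L \subset ground M ->
  geometry_free d.+1 (f @: L) -> matroid_free (PG2 d) (restrict M L).
Proof.
have [finj fn0] := simple_represents_inj simpleM repf.
move=> LM freeL [X XL /(geometry_of_iso (represents_restrict (represents_restrict repf)))].
have subL : ground (restrict (restrict M L) X) \subset L.
  by apply/subsetP=> x; rewrite !inE => /andP[/andP[]].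
case=> [x y /(subsetP subL)/(subsetP LM) xM /(subsetP subL)/(subsetP LM) | x | U dU UE].
- exact: finj.
- by move/(subsetP subL)/(subsetP LM)/fn0.
apply: (freeL U dU) => v vU v0.
by apply: subsetP (imsetS f subL) v (UE v vU v0).
Qed.

Lemma hyperplane_hyp (xi : 'rV['F_2]_r) (L := [set x in ground M | f x \in hyp xi]) :
  xi != 0%R -> mrank M (ground M) = r ->
  (forall U : {vspace 'rV['F_2]_r}, (forall x, x \in L -> f x \in U) -> r <= (\dim U).+1) ->
  hyperplane M L.
Proof.
move=> xi0 rankM spanL.
have LM : L \subset ground M by apply/subsetP=> x; rewrite inE => /andP[].
have spanH v : v \in image_span f L -> v \in hyp xi.
  rewrite mem_hyp_lker; apply: subvP; apply: image_span_subP => x.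
  by rewrite inE mem_hyp_lker => /andP[].
(* The spanning hypothesis bounds the rank of [L] below by r - 1; containment of its span in
   [hyp xi], of size 2^(r-1), bounds it above. *)
have rL : r = (mrank M L).+1.
  apply/eqP; rewrite eqn_leq (mrank_image_span repf LM) spanL; last first.
    by move=> x; apply: mem_image_span.
  have [cH _] := card_hyp xi0.
  have /subset_leq_card : image_span f L \subset hyp xi by apply/subsetP.
  rewrite card_vspace card_Fp // -(@ltn_exp2l 2) // -(card_rV2 r) -cH.
  have pos : 0 < 2 ^ \dim (image_span f L) by rewrite expn_gt0.
  by move: pos; move: (2 ^ _) #|hyp xi|; clear; lia.
rewrite /hyperplane /flat LM /= rankM -rL eqxx andbT.
apply/eqP/setP=> x; rewrite inE; have [xM | xM] := boolP (x \in ground M); last first.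
  by apply/esym/negbTE; apply: contra xM; apply: subsetP.
have [xL | xL] := boolP (x \in L); first by rewrite (setUidPr _) ?sub1set // eqxx.
(* Flatness: an element outside [L] is mapped off [hyp xi], hence outside the span of [L], so adding
   it raises the rank. *)
apply/negbTE; rewrite /= !(mrank_image_span repf) //; last first.
  by rewrite subUset sub1set xM.
have fx : f x \notin image_span f L.
  by apply: contra xL => /spanH fx; rewrite inE xM.
rewrite /image_span (eq_span (perm_mem (perm_map f (enum_setU1 xL)))) /=.
by rewrite span_cons addvC dim_add_line // neq_ltn ltnSn orbT.
Qed.

End HyperplaneOfMatroid.

Theorem theorem4p1 (r n : nat) (T : finType) (M : matroid T) :
  3 <= n -> n <= r ->
  simple_matroid M -> mrank M (ground M) = r -> binary M ->
  matroid_free (PG2 (n - 1)) M ->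
  ((1 - 3 / 2 ^+ n) * 2 ^+ r < #|ground M|%:R :> rat)%R ->
  exists L : {set T},
    [/\ hyperplane M L,
        matroid_free (PG2 (n - 2)) (restrict M L)
      & ((1 - 3 / 2 ^+ (n - 1)) * 2 ^+ (r - 1) < #|L|%:R :> rat)%R].
Proof.
move=> n3 nr simpleM rankM /binary_coordinates; rewrite rankM => -[f repf] freeM.
rewrite density_nat // => denseM.
have [finj fn0] := simple_represents_inj simpleM repf.
set E := f @: ground M.
have cardE : #|E| = #|ground M| by rewrite card_in_imset.
have E0 : 0%R \notin E.
  by apply/imsetP=> -[x /fn0 + f0]; rewrite -f0 eqxx.
have freeE : geometry_free n E.
  by have := matroid_free_geometry simpleM repf freeM; rewrite subn1 prednK // ltnW // ltnW.
have ltEC : #|~: E| < 3 * 2 ^ (r - n).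
  have := cardsC E; rewrite card_rV2 cardE.
  by move: denseM; move: #|~: E| (2 ^ r) (2 ^ (r - n)) #|ground M|; clear; lia.
have n3r : 3 <= n <= r by rewrite n3.
have [xi xi0 freeH] := dense_hyperplane n3r E0 freeE ltEC.
set L := [set x in ground M | f x \in hyp xi].
have LM : L \subset ground M by apply/subsetP=> x; rewrite inE => /andP[].
have fL : f @: L = E :&: hyp xi.
  apply/setP=> v; rewrite inE; apply/imsetP/andP => [[x] | [/imsetP[x xM ->] xH]].
    by rewrite inE => /andP[xM xH] ->; split=> //; apply: imset_f.
  by exists x; rewrite // inE xM.
exists L; split.
- apply: hyperplane_hyp => // U LU; apply: (dense_hyp_span n3r E0 ltEC xi0 freeH).
  by move=> v; rewrite -fL => /imsetP[x /LU + ->].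
- apply: (geometry_free_restrict simpleM repf LM).
  by rewrite fL (_ : (n - 2).+1 = n.-1) //; move: n3; clear; lia.
have cardL : #|E :&: hyp xi| = #|L|.
  by rewrite -fL card_in_imset // => x y /(subsetP LM) xM /(subsetP LM); apply: finj.
have r_gt0 : 0 < r by apply: leq_trans nr; apply: leq_trans n3.
(* As (r - 1) - (n - 1) = r - n, the allowed deficiency is unchanged, while passing from [E] to [L]
   loses at most the 2^(r-1) vectors off the hyperplane. *)
rewrite density_nat ?leq_sub2r // subnBA; last by apply: leq_trans n3.
rewrite subnK //; have := cardsID (hyp xi) E; rewrite cardE cardL.
have : #|E :\: hyp xi| <= #|~: hyp xi| by rewrite setDE subset_leq_card ?subsetIr.
have [_] := card_hyp xi0; rewrite card_rV2.
rewrite (_ : 2 ^ r = 2 * 2 ^ (r - 1)) in denseM *; last by rewrite -expnS subn1 prednK.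
move: denseM; move: (2 ^ (r - 1)) (2 ^ (r - n)) #|ground M| #|L| #|_ :\: _| #|~: _|.
by clear; lia.
Qed.
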